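(* (Maximal principle) Let $\mathcal{T}$ be a star triangulation of an $n$-sided polygon $P_n$ with boundary vertices $v_1,\dots,v_n$ and a unique interior vertex $v_0$, and let $E$ be its set of edges. Let $I$ be a regular weight on the edges with either $I:E\to(-1,1]$ or $I:E\to[0,+\infty)$, satisfying the structure condition: $I(e_i)+I(e_j)I(e_k)\ge 0$ for $\{i,j,k\}=\{1,2,3\}$, for every triangle of $\mathcal{T}$ with edges $e_1,e_2,e_3$. Suppose $\overline r$ and $r$ are two generalized inversive distance circle packings on $(P_n,\mathcal{T},I)$ such that (a) $\overline r$ and $r$ are generalized weighted Delaunay inversive distance circle packings on $(P_n,\mathcal{T},I)$; (b) the combinatorial curvatures at $v_0$ satisfy $K_0(r)\le K_0(\overline r)$; (c) $\max\{\frac{r_i}{\overline r_i}: i=1,2,\dots,n\}\le \frac{r_0}{\overline r_0}$. Then $\frac{r_i}{\overline r_i}$, $i=0,1,\dots,n$, is a constant independent of $i$.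
   Context: $P_n$ is a star-shaped $n$-sided polygon in the plane with boundary vertices $v_1,\dots,v_n$ cyclically ordered ($v_{n+i}=v_i$); $v_0$ is an interior point inducing the triangulation $\mathcal{T}$ of $P_n$ with triangles $\triangle v_0v_iv_{i+1}$, $i=1,\dots,n$. The interior edges are $v_0v_i$. Write $I_{ij}$ for the weight of the edge $v_iv_j$ and $r_i=r(v_i)$. The weight $I$ is regular if there are no adjacent triangles $t_1$ (with edges $a,b,e$) and $t_2$ (with edges $c,d,e$) such that $I(e)=1$, $I(a)=-I(b)$, $I(c)=-I(d)$. A generalized inversive distance circle packing is a map $r:\{v_0,\dots,v_n\}\to(0,+\infty)$ such that the edge lengths $l_{ij}=\sqrt{r_i^2+r_j^2+2r_ir_jI_{ij}}$ satisfy the (non-strict) triangle inequalities $l_{rs}\le l_{rt}+l_{st}$ on every face. A face is degenerate with flat vertex $v_k$ if $l_{ij}=l_{ik}+l_{jk}$; its inner angles are then $\pi$ at $v_k$ and $0$ at the other two vertices. Otherwise the face is a non-degenerate Euclidean triangle with its usual inner angles. $K_0(r)$ is $2\pi$ minus the sum of the inner angles at $v_0$ of all triangles $\triangle v_0v_iv_{i+1}$. For a face $\triangle v_iv_jv_k$ put $d_{ij}=\frac{r_i^2+r_ir_jI_{ij}}{l_{ij}}$. If the face is non-degenerate, its geometric center is the unique point $p$ of the plane with $|p-v_s|^2-r_s^2$ equal for $s=i,j,k$, and $h_{ij,k}$ is the signed distance from it to the line $v_iv_j$ (positive if it lies on the same side as the triangle, negative if on the other side); define $\theta_{ij,k}=\pi+\arctan\frac{h_{ij,k}}{d_{ij}}$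 if $d_{ij}<0$, $\theta_{ij,k}=\frac{\pi}{2}$ if $d_{ij}=0$, and $\theta_{ij,k}=\arctan\frac{h_{ij,k}}{d_{ij}}$ if $d_{ij}>0$. If the face is degenerate, $\theta_{ij,k}=\frac{\pi}{2}$ if $v_i$ or $v_j$ is the flat vertex, and $\theta_{ij,k}=-\frac{\pi}{2}$ if $v_k$ is the flat vertex. A generalized inversive distance circle packing is (generalized) weighted Delaunay if $\theta_{ij,k}+\theta_{ij,m}\ge0$ for every interior edge $v_iv_j$ shared by faces $\triangle v_iv_jv_k$ and $\triangle v_iv_jv_m$ (here for $v_i=v_0$ and $j=1,\dots,n$, with $k=j-1$, $m=j+1$). *)

(* Defs.v *)
From HB Require Import structures.
From mathcomp Require Import all_boot all_order all_algebra.
From mathcomp Require Import all_classical all_reals all_analysis.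

Set Implicit Arguments.
Unset Strict Implicit.
Unset Printing Implicit Defensive.

Import Order.TTheory GRing.Theory Num.Theory.
Local Open Scope classical_set_scope.
Local Open Scope ring_scope.

(* Vertices of the star triangulation of an n-gon: [None] is the interior
   vertex v_0, and [Some i], for i < n, is the boundary vertex v_(i+1).
   The cyclic successor and predecessor on 'I_n are [ordS] and [ord_pred], so
   the faces are the triangles [None], [Some i], [Some (ordS i)].  Only this
   combinatorial structure of the polygon is used. *)
Definition vertex (n : nat) : finType := option 'I_n.

Definition edge n : rel (vertex n) := fun x y =>
  match x, y with
  | None, None => false
  | Some i, Some j => (j == ordS i) || (i == ordS j)
  | _, _ => true
  end.

Section EuclideanPlane.
Variable R : realType.
Implicit Types a b c p : R * R.

(* The library norm on R * R is the sup norm. *)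
Definition edist a b : R :=
  Num.sqrt ((b.1 - a.1) ^+ 2 + (b.2 - a.2) ^+ 2).

(* Twice the signed area of the triangle a b c. *)
Definition cross a b c : R :=
  (b.1 - a.1) * (c.2 - a.2) - (b.2 - a.2) * (c.1 - a.1).

(* Signed distance from p to the line a b, positive on the side of c. *)
Definition signed_dist a b c p : R :=
  Num.sg (cross a b c) * (cross a b p / edist a b).

End EuclideanPlane.

Section Packing.
Variables (R : realType) (n : nat).
Implicit Types (I : vertex n -> vertex n -> R) (r : vertex n -> R).
Implicit Types x y z : vertex n.

(* A weight on the set of unoriented edges; values of [I] off the edges are
   never used. *)
Definition edge_weight I : Prop := forall x y, edge x y -> I x y = I y x.

Definition structure_condition I : Prop :=
  forall i : 'I_n,
    let e1 := I None (Some i) in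
    let e2 := I None (Some (ordS i)) in
    let e3 := I (Some i) (Some (ordS i)) in
    [/\ 0 <= e1 + e2 * e3, 0 <= e2 + e1 * e3 & 0 <= e3 + e1 * e2].

(* Two adjacent faces share an edge v_0 v_i, and their third vertices are the
   two neighbours of v_i on the boundary. *)
Definition regular_weight I : Prop :=
  forall i : 'I_n,
    ~ [/\ I None (Some i) = 1,
          I None (Some (ord_pred i)) = - I (Some i) (Some (ord_pred i)) &
          I None (Some (ordS i)) = - I (Some i) (Some (ordS i))].

Definition len I r x y : R :=
  Num.sqrt (r x ^+ 2 + r y ^+ 2 + 2 * r x * r y * I x y).

Definition generalized_packing I r : Prop :=
  (forall x, 0 < r x) /\
  (forall i : 'I_n,
     let l1 := len I r None (Some i) in
     let l2 := len I r None (Some (ordS i)) in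
     let l3 := len I r (Some i) (Some (ordS i)) in
     [/\ l1 <= l2 + l3, l2 <= l1 + l3 & l3 <= l1 + l2]).

(* The face x y z is degenerate with flat vertex z. *)
Definition flat I r x y z : bool :=
  len I r x y == len I r x z + len I r y z.

(* Inner angle at x of the face x y z. *)
Definition angle I r x y z : R :=
  if flat I r y z x then pi
  else if flat I r x z y || flat I r x y z then 0
  else acos ((len I r x y ^+ 2 + len I r x z ^+ 2 - len I r y z ^+ 2)
             / (2 * len I r x y * len I r x z)).

Definition K0 I r : R :=
  2 * pi - \sum_(i < n) angle I r None (Some i) (Some (ordS i)).

Definition edge_d I r x y : R :=
  (r x ^+ 2 + r x * r y * I x y) / len I r x y.

(* The points a, b, c place the face x y z isometrically in the plane. *)
Definition placement I r x y z (a b c : R * R) : Prop :=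
  [/\ edist a b = len I r x y, edist a c = len I r x z
    & edist b c = len I r y z].

Definition geometric_center r x y z (a b c p : R * R) : Prop :=
  edist p a ^+ 2 - r x ^+ 2 = edist p b ^+ 2 - r y ^+ 2 /\
  edist p b ^+ 2 - r y ^+ 2 = edist p c ^+ 2 - r z ^+ 2.

(* h_{xy,z}.  For a non-degenerate face the set below is a singleton: the
   geometric center is unique, and its signed distance to the line through x
   and y does not depend on the placement. *)
Definition edge_h I r x y z : R :=
  xget 0 [set h : R | exists a b c p : R * R,
    [/\ placement I r x y z a b c, geometric_center r x y z a b c p
      & h = signed_dist a b c p]].

Definition theta I r x y z : R :=
  if flat I r y z x || flat I r x z y then pi / 2
  else if flat I r x y z then - (pi / 2)
  else let d := edge_d I r x y in
       let h := edge_h I r x y z in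
       if d < 0 then pi + atan (h / d)
       else if d == 0 then pi / 2
       else atan (h / d).

(* The interior edges are the edges v_0 v_i, oriented from v_0. *)
Definition weighted_delaunay I r : Prop :=
  forall i : 'I_n,
    0 <= theta I r None (Some i) (Some (ord_pred i))
         + theta I r None (Some i) (Some (ordS i)).

End Packing.

(* Main.v *)
(* Put kappa_i = r_0 / r_i.  A weighted Delaunay inequality at v_0 v_i holds
   automatically if I(v_0 v_i) <= 1; if I(v_0 v_i) > 1 it is equivalent to a
   linear inequality in the kappa's (in the hyperbolic picture: convexity at one
   vertex of a polygon with fixed edge lengths, written in cosh of the
   distances to the cone point).  The triangle inequalities of a face cut out
   one nappe of a quadratic cone in (1, kappa_i, kappa_j).  Hence the segment
   between the kappa's of the two packings consists of weighted Delaunay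
   packings, with non-degenerate faces in its interior unless the face is
   constant.  Along it the total angle at v_0 is monotone, so by the mean value
   theorem its derivative vanishes termwise at some point.  At a vertex whose
   kappa changes this contradicts regularity if I(v_0 v_i) <= 1; otherwise the
   linear Delaunay inequalities are equalities for both packings, and a discrete
   maximum principle for the difference of the kappa's, weighted by
   1 / sqrt (I(v_0 v_i)^2 - 1), gives the contradiction. *)
Require Import Defs.
From HB Require Import structures.
From mathcomp Require Import all_boot all_order all_algebra.
From mathcomp Require Import all_classical all_reals all_analysis.
From mathcomp Require Import ring lra.

Set Implicit Arguments.
Unset Strict Implicit.
Unset Printing Implicit Defensive.

Import Order.TTheory GRing.Theory Num.Theory.
Import numFieldNormedType.Exports.
Local Open Scope ring_scope.

(** * Algebra of a single face: identities and signs, and non-degeneracy along segments *)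

Section FaceAlgebra.
Variable R : rcfType.
Implicit Types p q s x y t : R.

(* A face v_0 v_i v_j is described by the weights p, q, s of v_0 v_i, v_0 v_j,
   v_i v_j and by x = r_0 / r_i, y = r_0 / r_j.  Then edge_form is
   (l_0i / r_i)^2, cos_num is the cosine of the angle at v_0 times
   l_0i l_0j / (r_i r_j), gram is (2 area / (r_i r_j))^2, and height is a
   positive multiple of area * h_{0i,j}. *)
Definition edge_form p x : R := x ^+ 2 + 2 * p * x + 1.
Definition cos_num p q s x y : R := x * y + p * y + q * x - s.
Definition gram p q s x y : R :=
  edge_form p x * edge_form q y - cos_num p q s x y ^+ 2.
Definition height p q s x y : R :=
  (y + q) * (1 - p ^+ 2) + (x + p) * (s + p * q).
Definition discr p q s : R := p ^+ 2 + q ^+ 2 + s ^+ 2 + 2 * p * q * s - 1.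

Definition face_weights p q s : Prop :=
  [/\ -1 < p, -1 < q & -1 < s] /\
  [/\ 0 <= p + q * s, 0 <= q + p * s & 0 <= s + p * q] /\
  ([/\ p <= 1, q <= 1 & s <= 1] \/ [/\ 0 <= p, 0 <= q & 0 <= s]).

Definition face_cos p q s x y : R :=
  cos_num p q s x y / Num.sqrt (edge_form p x * edge_form q y).

Lemma face_weightsC p q s : face_weights p q s -> face_weights q p s.
Proof.
case=> -[a b c] [[d e f] g]; rewrite /face_weights [q * p]mulrC.
by split=> //; split=> //; case: g => -[? ? ?]; [left|right].
Qed.

Lemma cos_numC p q s x y : cos_num p q s x y = cos_num q p s y x.
Proof. by rewrite /cos_num; ring. Qed.

Lemma gramC p q s x y : gram p q s x y = gram q p s y x.
Proof. by rewrite /gram cos_numC [edge_form p x * _]mulrC. Qed.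

(** Take w, a, b of square 1 with products wa = p, wb = q, ab = -s, and put A = xw + a, B = yw + b.
    Then [edge_form p x] is the square of A, [gram] is the Gram determinant of A and B, [discr] is
    minus that of w, a, b, and [height] is, up to sign, the minor pairing (w, A) with (A, B). The
    identity is Jacobi's for these minors. *)
Lemma height_sqr p q s x y :
  height p q s x y ^+ 2 =
  edge_form p x * discr p q s + (1 - p ^+ 2) * gram p q s x y.
Proof.
by rewrite /height /edge_form /discr /gram /edge_form /cos_num; ring.
Qed.

Lemma edge_form_gt0 p x : -1 < p -> 0 < x -> 0 < edge_form p x.
Proof.
move=> p1 x0; have -> : edge_form p x = (x - 1) ^+ 2 + 2 * (1 + p) * x.
  by rewrite /edge_form; ring.
by rewrite ltr_wpDl ?sqr_ge0// !mulr_gt0//; lra.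
Qed.

Lemma discr_gt0 p q s : face_weights p q s -> 1 < p -> 0 < discr p q s.
Proof.
move=> [_ [_ [[p1 _ _]|[p0 q0 s0]]]] p_gt1; first by lra.
have -> : discr p q s = (p - 1) * (p + 1) + q ^+ 2 + s ^+ 2 + 2 * p * q * s.
  by rewrite /discr; ring.
have : 0 < (p - 1) * (p + 1) by apply: mulr_gt0; lra.
have := sqr_ge0 q; have := sqr_ge0 s.
have : 0 <= 2 * p * q * s by rewrite !mulr_ge0.
lra.
Qed.

Lemma height_ge0 p q s x y : face_weights p q s -> p <= 1 ->
  0 < x -> 0 < y -> 0 <= height p q s x y.
Proof.
move=> [[p1 _ _] [[_ ga gb] _]] p_le1 x0 y0.
have -> : height p q s x y =
   y * ((1 - p) * (1 + p)) + (q + p * s) + x * (s + p * q).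
  by rewrite /height; ring.
have ? : 0 <= y * ((1 - p) * (1 + p)).
  by rewrite mulr_ge0 ?mulr_ge0 ?(ltW y0)//; lra.
have ? : 0 <= x * (s + p * q) by rewrite mulr_ge0// ltW.
lra.
Qed.

(** If p < 1, the first summand of [height] is positive; at p = 1 what remains is (1 + x)(q + s).
    The conclusion is one face's half of the configuration excluded by regularity. *)
Lemma height_eq0 p q s x y : face_weights p q s -> p <= 1 ->
  0 < x -> 0 < y -> height p q s x y = 0 -> p = 1 /\ q = - s.
Proof.
move=> [[p1 _ _] [[_ ga gb] _]] p_le1 x0 y0.
have -> : height p q s x y =
   y * ((1 - p) * (1 + p)) + (q + p * s) + x * (s + p * q).
  by rewrite /height; ring.
have xg : 0 <= x * (s + p * q) by rewrite mulr_ge0// ltW.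
move: p_le1; rewrite le_eqVlt => /orP[/eqP pE|p_lt1].
  by rewrite pE in xg ga * => e; split=> //; move: e xg ga; lra.
have : 0 < y * ((1 - p) * (1 + p)) by rewrite !mulr_gt0//; lra.
lra.
Qed.

(** Serves to show that at an edge of weight above 1 the structure inequality s + pq >= 0 cannot be
    an equality in both adjacent faces. *)
Lemma height_lt0 p q s x y : 1 < p -> 0 <= q -> 0 < y -> s + p * q = 0 ->
  height p q s x y < 0.
Proof.
move=> p1 q0 y0 g0; rewrite /height g0 mulr0 addr0 pmulr_rlt0; last by lra.
have : 1 < p ^+ 2 by rewrite expr_gt1//; lra.
lra.
Qed.

(* q has signature (1, 2); the condition 0 < F selects one nappe of its cone. *)
Lemma cone_segment_gt0 (d c F1 H1 Y1 F2 H2 Y2 t : R) :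
  let q F H Y := d * F ^+ 2 - H ^+ 2 - c * Y ^+ 2 in
  0 < c -> 0 < F1 -> 0 < F2 -> 0 <= q F1 H1 Y1 -> 0 <= q F2 H2 Y2 ->
  F2 * H1 != F1 * H2 \/ F2 * Y1 != F1 * Y2 -> 0 < t < 1 ->
  0 < q ((1 - t) * F1 + t * F2) ((1 - t) * H1 + t * H2)
        ((1 - t) * Y1 + t * Y2).
Proof.
move=> q c0 F10 F20 q1 q2 neq /andP[t0 t1].
pose B := d * F1 * F2 - H1 * H2 - c * Y1 * Y2.
have -> : q ((1 - t) * F1 + t * F2) ((1 - t) * H1 + t * H2)
     ((1 - t) * Y1 + t * Y2) =
  (1 - t) ^+ 2 * q F1 H1 Y1 + 2 * (t * (1 - t)) * B + t ^+ 2 * q F2 H2 Y2.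
  by rewrite /q /B; ring.
(* Reverse Cauchy-Schwarz inequality for the polar form [B] of [q]: it is strict because the two
   vectors are not proportional. *)
have B0 : 0 < B.
  have e : (2 * (F1 * F2)) * B = q F1 H1 Y1 * F2 ^+ 2 + q F2 H2 Y2 * F1 ^+ 2 +
     (F2 * H1 - F1 * H2) ^+ 2 + c * (F2 * Y1 - F1 * Y2) ^+ 2.
    by rewrite /q /B; ring.
  have F0 : 0 < 2 * (F1 * F2) by rewrite !mulr_gt0.
  rewrite -(pmulr_rgt0 _ F0) e.
  have ? : 0 <= q F1 H1 Y1 * F2 ^+ 2 by rewrite mulr_ge0 ?sqr_ge0.
  have ? : 0 <= q F2 H2 Y2 * F1 ^+ 2 by rewrite mulr_ge0 ?sqr_ge0.
  have sH := sqr_ge0 (F2 * H1 - F1 * H2).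
  have sY := sqr_ge0 (F2 * Y1 - F1 * Y2).
  have ? : 0 <= c * (F2 * Y1 - F1 * Y2) ^+ 2 by rewrite mulr_ge0// ltW.
  case: neq => neq.
    have : 0 < (F2 * H1 - F1 * H2) ^+ 2.
      by rewrite exprn_even_gt0//= subr_eq0 neq.
    lra.
  have : 0 < c * (F2 * Y1 - F1 * Y2) ^+ 2.
    by rewrite mulr_gt0// exprn_even_gt0//= subr_eq0 neq.
  lra.
have ? : 0 < 2 * (t * (1 - t)) * B by rewrite !mulr_gt0//; lra.
have ? : 0 <= (1 - t) ^+ 2 * q F1 H1 Y1 by rewrite mulr_ge0 ?sqr_ge0.
have ? : 0 <= t ^+ 2 * q F2 H2 Y2 by rewrite mulr_ge0 ?sqr_ge0.
lra.
Qed.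

(** By [height_sqr], (p^2 - 1) [gram] is the form of [cone_segment_gt0] in F = x + p, H = [height],
    Y = 1. These are affine in (x, y), so segments go to segments, and the constant Y makes
    proportional vectors equal. *)
Lemma gram_segment_gt0_large p q s x1 y1 x2 y2 t :
  face_weights p q s -> 1 < p -> 0 < x1 -> 0 < y1 -> 0 < x2 -> 0 < y2 ->
  0 <= gram p q s x1 y1 -> 0 <= gram p q s x2 y2 ->
  (x1, y1) != (x2, y2) -> 0 < t < 1 ->
  0 < gram p q s ((1 - t) * x1 + t * x2) ((1 - t) * y1 + t * y2).
Proof.
move=> fw p1 x10 y10 x20 y20 Q1 Q2 neq t01.
have D0 := discr_gt0 fw p1.
have c0 : 0 < p ^+ 2 - 1 by rewrite subr_gt0 expr_gt1//; lra.
have E x y : (p ^+ 2 - 1) * gram p q s x y = discr p q s * (x + p) ^+ 2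
     - height p q s x y ^+ 2 - (discr p q s * (p ^+ 2 - 1)) * 1 ^+ 2.
  by rewrite height_sqr /edge_form; ring.
rewrite -(pmulr_rgt0 _ c0) E.
have -> : (1 - t) * x1 + t * x2 + p = (1 - t) * (x1 + p) + t * (x2 + p).
  by ring.
have -> : height p q s ((1 - t) * x1 + t * x2) ((1 - t) * y1 + t * y2) =
  (1 - t) * height p q s x1 y1 + t * height p q s x2 y2.
  by rewrite /height; ring.
have -> : 1 ^+ 2 = ((1 - t) * 1 + t * 1) ^+ 2 :> R by ring.
apply: cone_segment_gt0 => //; rewrite -?E.
- exact: mulr_gt0.
- lra.
- lra.
- by rewrite mulr_ge0// ltW.
- by rewrite mulr_ge0// ltW.
have [ex|nx] := eqVneq x1 x2; last first.
  by right; rewrite !mulr1; apply: contra_neq nx; lra.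
left; rewrite ex; have xp0 : x2 + p != 0 by rewrite gt_eqF//; lra.
rewrite (inj_eq (mulfI xp0)) /height (inj_eq (addIr _)).
have nz : 1 - p ^+ 2 != 0 by rewrite lt_eqF//; lra.
rewrite (inj_eq (mulIf nz)) (inj_eq (addIr _)).
by apply: contra_neq neq => ->; rewrite ex.
Qed.

(** When the boundary edge has weight above 1, squares are completed with F = x + s y, H = [H0], Y =
    y instead. *)
Lemma gram_segment_gt0_opp p q s x1 y1 x2 y2 t :
  face_weights p q s -> 1 < s -> 0 < x1 -> 0 < y1 -> 0 < x2 -> 0 < y2 ->
  0 <= gram p q s x1 y1 -> 0 <= gram p q s x2 y2 ->
  (x1, y1) != (x2, y2) -> 0 < t < 1 ->
  0 < gram p q s ((1 - t) * x1 + t * x2) ((1 - t) * y1 + t * y2).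
Proof.
move=> fw s1 x10 y10 x20 y20 Q1 Q2 neq t01.
have D0 : 0 < discr p q s.
  have -> : discr p q s = discr s q p by rewrite /discr; ring.
  apply: discr_gt0 => //; case: fw => -[a b c] [[d e f] g].
  split=> //; split.
    by split; rewrite ?[s * q]mulrC ?[s * p]mulrC ?[q * p]mulrC//.
  by case: g => -[? ? ?]; [left|right].
pose H0 x y := (1 - s ^+ 2) + x * (p + q * s) + y * (q + p * s).
have c0 : 0 < s ^+ 2 - 1 by rewrite subr_gt0 expr_gt1//; lra.
have E x y : (s ^+ 2 - 1) * gram p q s x y = discr p q s * (x + s * y) ^+ 2
     - H0 x y ^+ 2 - (discr p q s * (s ^+ 2 - 1)) * y ^+ 2.
  by rewrite /gram /discr /H0 /cos_num /edge_form; ring.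
have F0 x y : 0 < x -> 0 < y -> 0 < x + s * y.
  by move=> ? ?; rewrite addr_gt0// mulr_gt0//; lra.
rewrite -(pmulr_rgt0 _ c0) E.
have -> : (1 - t) * x1 + t * x2 + s * ((1 - t) * y1 + t * y2) =
   (1 - t) * (x1 + s * y1) + t * (x2 + s * y2) by ring.
have -> : H0 ((1 - t) * x1 + t * x2) ((1 - t) * y1 + t * y2) =
  (1 - t) * H0 x1 y1 + t * H0 x2 y2.
  by rewrite /H0; ring.
apply: cone_segment_gt0 => //; rewrite -?E.
- exact: mulr_gt0.
- exact: F0.
- exact: F0.
- by rewrite mulr_ge0// ltW.
- by rewrite mulr_ge0// ltW.
have [e1|] := eqVneq ((x2 + s * y2) * y1) ((x1 + s * y1) * y2); last by right.
left; apply: contra_neq neq => e2.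
(* Proportional vectors have equal ratios x / y; the constant term 1 - s^2 of [H0] then forces y1 =
   y2. *)
have e3 : x2 * y1 = x1 * y2 by move: e1; rewrite !mulrDl; lra.
have y12 : y1 = y2.
  have : (y1 * (x2 + s * y2)) * H0 x1 y1 = (y1 * (x1 + s * y1)) * H0 x2 y2.
    by rewrite -!mulrA e2.
  rewrite [y1 * (x2 + _)]mulrC e1 -[y1 * (x1 + _)]mulrC => /esym.
  rewrite -!mulrA => /(mulfI (lt0r_neq0 (F0 _ _ x10 y10))) e4.
  have : (y1 - y2) * (s ^+ 2 - 1) = 0.
    have -> : (y1 - y2) * (s ^+ 2 - 1) =
      (y2 * H0 x1 y1 - y1 * H0 x2 y2) + (x2 * y1 - x1 * y2) * (p + q * s).
      by rewrite /H0; ring.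
    by rewrite e4 e3 !subrr mul0r addr0.
  by move/eqP; rewrite mulf_eq0 (gt_eqF c0) orbF subr_eq0 => /eqP.
move: e3; rewrite y12 => /(mulIf (lt0r_neq0 y20)) ->.
by [].
Qed.

(** [gram] expands into nonnegative terms. A positive one is the constant term if s < 1, the y^2
    term if p < 1, and (p + q s) x = (1 + q) x if s = p = 1. *)
Lemma gram_gt0_small p q s x y : face_weights p q s ->
  p <= 1 -> q <= 1 -> s <= 1 -> 0 < x -> 0 < y -> 0 < gram p q s x y.
Proof.
move=> [[p1 q1 s1] [[gp gq gs] _]] pl ql sl x0 y0.
have -> : gram p q s x y = (1 - s) * (1 + s) + x ^+ 2 * ((1 - q) * (1 + q)) +
   y ^+ 2 * ((1 - p) * (1 + p)) + 2 * ((p + q * s) * x + (q + p * s) * y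
    + (s + p * q) * (x * y)).
  by rewrite /gram /edge_form /cos_num; ring.
have h1 : 0 <= (1 - s) * (1 + s) by apply: mulr_ge0; lra.
have h2 : 0 <= x ^+ 2 * ((1 - q) * (1 + q)).
  by rewrite mulr_ge0 ?sqr_ge0// mulr_ge0//; lra.
have h3 : 0 <= y ^+ 2 * ((1 - p) * (1 + p)).
  by rewrite mulr_ge0 ?sqr_ge0// mulr_ge0//; lra.
have h4 : 0 <= (p + q * s) * x by rewrite mulr_ge0// ltW.
have h5 : 0 <= (q + p * s) * y by rewrite mulr_ge0// ltW.
have h6 : 0 <= (s + p * q) * (x * y) by rewrite mulr_ge0// ltW// mulr_gt0.
move: sl; rewrite le_eqVlt => /orP[/eqP s1E|s_lt1]; last first.
  have : 0 < (1 - s) * (1 + s) by apply: mulr_gt0; lra.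
  lra.
move: pl; rewrite le_eqVlt => /orP[/eqP p1E|p_lt1]; last first.
  have : 0 < y ^+ 2 * ((1 - p) * (1 + p)).
    by rewrite mulr_gt0 ?exprn_gt0// mulr_gt0//; lra.
  lra.
have : 0 < (p + q * s) * x by rewrite mulr_gt0// s1E p1E; lra.
lra.
Qed.

Lemma gram_segment_gt0 p q s x1 y1 x2 y2 t :
  face_weights p q s -> 0 < x1 -> 0 < y1 -> 0 < x2 -> 0 < y2 ->
  0 <= gram p q s x1 y1 -> 0 <= gram p q s x2 y2 ->
  (x1, y1) != (x2, y2) -> 0 < t < 1 ->
  0 < gram p q s ((1 - t) * x1 + t * x2) ((1 - t) * y1 + t * y2).
Proof.
move=> fw x10 y10 x20 y20 Q1 Q2 neq t01.
have [pl|] := leP p 1; last by move=> ?; exact: gram_segment_gt0_large.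
have [ql|q1] := leP q 1; last first.
  rewrite gramC; apply: gram_segment_gt0_large; rewrite 1?gramC//.
    exact: face_weightsC.
  by apply: contra_neq neq => -[-> ->].
have [sl|] := leP s 1; last by move=> ?; exact: gram_segment_gt0_opp.
case/andP: t01 => t0 t1.
by apply: gram_gt0_small => //; rewrite addr_gt0// mulr_gt0//; lra.
Qed.

(* With h = sqrt A * T and k = sqrt B * U the hypotheses say that
   h / sqrt A' = sqrt c * T / sqrt (m - T^2), an increasing odd function of T,
   and similarly for k. *)
Lemma sum_div_sqrt_ge0 (h k A B A' B' m c : R) :
  0 < A -> 0 < B -> 0 < A' -> 0 < B' -> 0 < m -> 0 < c ->
  c * A' = m * A - h ^+ 2 -> c * B' = m * B - k ^+ 2 ->
  (0 <= h / Num.sqrt A + k / Num.sqrt B) =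
  (0 <= h / Num.sqrt A' + k / Num.sqrt B').
Proof.
move=> A0 B0 A'0 B'0 m0 c0 eA eB.
have pos (a b u v : R) : 0 < u -> 0 < v -> 0 <= a -> 0 <= b ->
    (0 <= a / Num.sqrt u - b / Num.sqrt v) = (b ^+ 2 * u <= a ^+ 2 * v).
  move=> u0 v0 a0 b0; rewrite subr_ge0.
  have su : 0 < Num.sqrt u by rewrite sqrtr_gt0.
  have sv : 0 < Num.sqrt v by rewrite sqrtr_gt0.
  have au : a / Num.sqrt u \is Num.nneg by rewrite nnegrE divr_ge0 ?sqrtr_ge0.
  have bv : b / Num.sqrt v \is Num.nneg by rewrite nnegrE divr_ge0 ?sqrtr_ge0.
  rewrite -(ler_sqr bv au) !expr_div_n (sqr_sqrtr (ltW u0)).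
  by rewrite (sqr_sqrtr (ltW v0)) ler_pdivrMr// mulrAC ler_pdivlMr.
(* After substituting c A' = m A - h^2 and c B' = m B - k^2, the terms h^2 k^2 cancel. *)
have key : (k ^+ 2 * A <= h ^+ 2 * B) = (k ^+ 2 * A' <= h ^+ 2 * B').
  rewrite -(ler_pM2l m0) -[RHS](ler_pM2l c0).
  rewrite ![m * (_ * _)]mulrCA ![c * (_ * _)]mulrCA eA eB !mulrBr.
  by rewrite [h ^+ 2 * k ^+ 2]mulrC lerD2r.
have key' : (h ^+ 2 * B <= k ^+ 2 * A) = (h ^+ 2 * B' <= k ^+ 2 * A').
  rewrite -(ler_pM2l m0) -[RHS](ler_pM2l c0).
  rewrite ![m * (_ * _)]mulrCA ![c * (_ * _)]mulrCA eA eB !mulrBr.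
  by rewrite [h ^+ 2 * k ^+ 2]mulrC lerD2r.
have ge0 (a u : R) : 0 < u -> (0 <= a / Num.sqrt u) = (0 <= a).
  by move=> u0; rewrite pmulr_lge0// invr_gt0 sqrtr_gt0.
have lt0 (a u : R) : 0 < u -> (a / Num.sqrt u < 0) = (a < 0).
  by move=> u0; rewrite pmulr_llt0// invr_gt0 sqrtr_gt0.
have [h0|h0] := leP 0 h; have [k0|k0] := leP 0 k.
- by rewrite !addr_ge0// ge0.
- have nk u : k / u = - (- k / u) by rewrite mulNr opprK.
  by rewrite !(nk (Num.sqrt _)) !pos// ?oppr_ge0 ?(ltW k0)// sqrrN key.
- have nh u : h / u = - (- h / u) by rewrite mulNr opprK.
  rewrite !(nh (Num.sqrt _)) ![- (_ / _) + _]addrC.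
  by rewrite !pos// ?oppr_ge0 ?(ltW h0)// sqrrN key'.
- have neg (u v : R) : 0 < u -> 0 < v ->
      (0 <= h / Num.sqrt u + k / Num.sqrt v) = false.
    move=> u0 v0; apply/negbTE; rewrite -ltNge.
    have := lt0 h u u0; have := lt0 k v v0; rewrite h0 k0; lra.
  by rewrite !neg.
Qed.

End FaceAlgebra.

(** * From the angle form of the Delaunay condition to a linear inequality *)

Section Slope.
Variable R : realType.
Implicit Types (H Q D th : R).

(** The values of [theta] on a face with d > 0: f is a positive multiple of d, H of [height], and Q
    = 0 is the degenerate case, where the sign of H tells which vertex is flat. *)
Definition theta_spec (f H Q th : R) : Prop :=
  (0 < Q /\ th = atan (H / (f * Num.sqrt Q))) \/
  (Q = 0 /\ (th = pi / 2 /\ 0 < H \/ th = - (pi / 2) /\ H < 0)).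

(** If both Q are positive, monotonicity of atan removes f and [sum_div_sqrt_ge0] replaces Q by D.
    In general |H / sqrt D| <= sqrt m, with equality when Q = 0. So an angle pi / 2 outweighs any
    other term, and an angle -pi / 2 can only be balanced by pi / 2. *)
Lemma slope_of_theta (f m k H1 Q1 D1 th1 H2 Q2 D2 th2 : R) :
  0 < f -> 0 < m -> 0 < k -> 0 < D1 -> 0 < D2 ->
  k * Q1 = m * D1 - H1 ^+ 2 -> k * Q2 = m * D2 - H2 ^+ 2 ->
  theta_spec f H1 Q1 th1 -> theta_spec f H2 Q2 th2 ->
  0 <= th1 + th2 -> 0 <= H1 / Num.sqrt D1 + H2 / Num.sqrt D2.
Proof.
move=> f0 m0 k0 D10 D20 e1 e2 t1 t2 th12.
have Q_ge0 H Q th : theta_spec f H Q th -> 0 <= Q.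
  by case=> [[/ltW]|[->]].
have bound H Q D : 0 < D -> 0 <= Q -> k * Q = m * D - H ^+ 2 ->
    `|H / Num.sqrt D| <= Num.sqrt m.
  move=> D0 Q0 e; rewrite -sqrtr_sqr ler_wsqrtr//.
  rewrite expr_div_n (sqr_sqrtr (ltW D0)).
  by rewrite ler_pdivrMr// -subr_ge0 -e mulr_ge0// ltW.
have bound_eq H D : 0 < D -> k * 0 = m * D - H ^+ 2 ->
    `|H / Num.sqrt D| = Num.sqrt m.
  move=> D0 e; rewrite -sqrtr_sqr expr_div_n (sqr_sqrtr (ltW D0)).
  have -> : H ^+ 2 = m * D by move: e; rewrite mulr0; lra.
  by rewrite mulfK// lt0r_neq0.
have pos H D : 0 < D -> k * 0 = m * D - H ^+ 2 -> 0 < H ->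
    H / Num.sqrt D = Num.sqrt m.
  by move=> D0 e H0; rewrite -(bound_eq H D)// gtr0_norm// divr_gt0 ?sqrtr_gt0.
have pi2 : 0 < (pi : R) / 2 by rewrite divr_gt0// pi_gt0.
have := bound _ _ _ D10 (Q_ge0 _ _ _ t1) e1.
have := bound _ _ _ D20 (Q_ge0 _ _ _ t2) e2.
rewrite !ler_norml => /andP[b2 b2'] /andP[b1 b1'].
case: t1 => [[Q10 th1E]|[Q10 [[th1E H10]|[th1E H10]]]]; last first.
- case: t2 => [[Q20 th2E]|[Q20 [[th2E H20]|[th2E H20]]]].
  + have := atan_ltpi2 (H2 / (f * Num.sqrt Q2)).
    by move: th12; rewrite th1E th2E; lra.
  + by move: b1; rewrite -(pos H2 D2)// -?Q20//; lra.
  + by move: th12; rewrite th1E th2E; lra.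
- by move: b2; rewrite -(pos H1 D1)// -?Q10//; lra.
case: t2 => [[Q20 th2E]|[Q20 [[th2E H20]|[th2E H20]]]].
- rewrite (sum_div_sqrt_ge0 D10 D20 Q10 Q20 m0 k0 e1 e2).
  have : - (H2 / (f * Num.sqrt Q2)) <= H1 / (f * Num.sqrt Q1).
    rewrite leNgt; apply/negP => /lt_atan; rewrite atanN -th1E -th2E.
    by move: th12; lra.
  rewrite -subr_ge0 opprK.
  have -> : H1 / (f * Num.sqrt Q1) + H2 / (f * Num.sqrt Q2) =
      f^-1 * (H1 / Num.sqrt Q1 + H2 / Num.sqrt Q2).
    by rewrite !invfM; ring.
  by rewrite pmulr_rge0// invr_gt0.
- by move: b1; rewrite -(pos H2 D2)// -?Q20//; lra.
- have := atan_ltpi2 (H1 / (f * Num.sqrt Q1)).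
  by move: th12; rewrite th1E th2E; lra.
Qed.

(** For p, q > 1 positivity of [discr] = (s + pq)^2 - (p^2 - 1)(q^2 - 1) gives sqrt (p^2 - 1) sqrt
    (q^2 - 1) < s + pq, which beats the negative term once b is bounded by a in the given scale. *)
Lemma tilt_ge0 (p q s a b : R) : face_weights p q s -> 1 < p -> 0 < a ->
  0 <= b ->
  (b != 0 -> 1 < q /\ b / Num.sqrt (q ^+ 2 - 1) <= a / Num.sqrt (p ^+ 2 - 1)) ->
  0 <= b * (1 - p ^+ 2) + a * (s + p * q) /\
  (s + p * q != 0 -> 0 < b * (1 - p ^+ 2) + a * (s + p * q)).
Proof.
move=> fw p1 a0 b0 hb; have [_ [[_ _ g0] _]] := fw.
have [b_eq0|bn0] := eqVneq b 0.
  rewrite b_eq0 mul0r add0r; split; first by rewrite mulr_ge0// ltW.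
  by move=> g_neq0; rewrite mulr_gt0// lt0r g_neq0.
suff : 0 < b * (1 - p ^+ 2) + a * (s + p * q).
  by move=> h; split=> //; exact: ltW.
have [q1 ba] := hb bn0.
have P0 : 0 < p ^+ 2 - 1 by rewrite subr_gt0 expr_gt1//; lra.
have Q0 : 0 < q ^+ 2 - 1 by rewrite subr_gt0 expr_gt1//; lra.
have D0 := discr_gt0 fw p1.
move: (sqr_sqrtr (ltW P0)) (sqr_sqrtr (ltW Q0)) ba.
have : 0 < Num.sqrt (p ^+ 2 - 1) by rewrite sqrtr_gt0.
have : 0 < Num.sqrt (q ^+ 2 - 1) by rewrite sqrtr_gt0.
set u := Num.sqrt (p ^+ 2 - 1); set v := Num.sqrt (q ^+ 2 - 1) => v0 u0 u2 v2.
rewrite ler_pdivrMr// mulrAC ler_pdivlMr// => bu.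
have uv : u * v < s + p * q.
  rewrite -ltr_sqr ?nnegrE ?mulr_ge0 ?(ltW u0) ?(ltW v0)//.
  rewrite exprMn u2 v2 -subr_gt0.
  by move: D0; rewrite /discr; congr (0 < _); ring.
have -> : 1 - p ^+ 2 = - (u ^+ 2) by rewrite u2; ring.
have : b * u * u <= a * v * u by rewrite ler_pM2r.
have : a * (u * v) < a * (s + p * q) by rewrite ltr_pM2l.
lra.
Qed.

End Slope.

(** * Continuity and derivative of the angle at v_0 *)

Local Open Scope classical_set_scope.

Lemma within_continuous_comp_within (T U V : topologicalType) (A : set T)
    (B : set U) (f : T -> U) (g : U -> V) :
  {within A, continuous f} -> {within B, continuous g} -> f @` A `<=` B ->
  {within A, continuous (g \o f)}.
Proof.
move=> /subspace_continuousP cf /subspace_continuousP cg fAB.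
apply/subspace_continuousP => x Ax W /= gW.
have Bfx : B (f x) by apply: fAB; exists x.
have /= hf := cf x Ax _ (cg _ Bfx W gW).
rewrite /nbhs /= /within /= in hf *.
by apply: filterS hf => z hz Az /=; apply: hz => //; apply: fAB; exists z.
Qed.

Section Angle.
Variable R : realType.
Implicit Types p q s : R.

(** Obtained from the inverse of cos on [0, pi]; the end points matter because degenerate faces have
    cosine 1 or -1. *)
Lemma within_continuous_acos :
  {within `[-1, 1]%classic, continuous (@acos R)}.
Proof.
have := @segment_can_ge_continuous R 0 pi cos acos (pi_ge0 R).
rewrite cos0 cospi; apply.
  by apply: continuous_subspaceT; exact: continuous_cos.
by move=> z z0; exact: cosK.
Qed.

Lemma face_cos_itv p q s x y : 0 < edge_form p x -> 0 < edge_form q y ->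
  0 <= gram p q s x y -> -1 <= face_cos p q s x y <= 1.
Proof.
move=> m0 m'0 Q0; rewrite -ler_norml /face_cos normrM normfV.
have mm : 0 < edge_form p x * edge_form q y by rewrite mulr_gt0.
have s0 : 0 < Num.sqrt (edge_form p x * edge_form q y) by rewrite sqrtr_gt0.
rewrite (gtr0_norm s0) ler_pdivrMr// mul1r -sqrtr_sqr ler_wsqrtr//.
by move: Q0; rewrite /gram subr_ge0.
Qed.

Lemma face_cos_sqr p q s x y : 0 < edge_form p x -> 0 < edge_form q y ->
  1 - face_cos p q s x y ^+ 2 =
  gram p q s x y / (edge_form p x * edge_form q y).
Proof.
move=> m0 m'0; rewrite /face_cos expr_div_n sqr_sqrtr ?mulr_ge0 ?ltW//.
by rewrite /gram; field; rewrite !lt0r_neq0.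
Qed.

(** Common shape of [edge_form], which is (x + p)^2 + 1 - p^2, and [cos_num], which is (x + p)(y +
    q) - s - pq. *)
Lemma is_derive_mul_shift (X Y : R -> R) (t dx dy a b c : R) :
  is_derive t 1 X dx -> is_derive t 1 Y dy ->
  is_derive t 1 (fun z => (X z + a) * (Y z + b) + c)
    ((X t + a) * dy + (Y t + b) * dx).
Proof.
move=> dX dY.
have dXa : is_derive t 1 (X + cst a) (dx + 0) by exact: is_deriveD.
have dYb : is_derive t 1 (Y + cst b) (dy + 0) by exact: is_deriveD.
have dXY := is_deriveM dXa dYb.
have dXYc := is_deriveD dXY (is_derive_cst c t 1).
by apply: (is_derive_eq dXYc); rewrite !addr0.
Qed.

Lemma is_derive_edge_form p (X : R -> R) (t dx : R) : is_derive t 1 X dx ->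
  is_derive t 1 (fun z => edge_form p (X z)) ((2 * X t + 2 * p) * dx).
Proof.
move=> dX; have d := is_derive_mul_shift p p (1 - p ^+ 2) dX dX.
rewrite (_ : (fun z => _) = fun z => (X z + p) * (X z + p) + (1 - p ^+ 2)).
  by apply: (is_derive_eq d); ring.
by apply/funext => z; rewrite /edge_form; ring.
Qed.

Lemma is_derive_face_cos p q s (X Y : R -> R) (t dx dy : R) :
  0 < edge_form p (X t) -> 0 < edge_form q (Y t) ->
  is_derive t 1 X dx -> is_derive t 1 Y dy ->
  is_derive t 1 (fun z => face_cos p q s (X z) (Y z))
    ((dx * height p q s (X t) (Y t) / edge_form p (X t) +
      dy * height q p s (Y t) (X t) / edge_form q (Y t))
     / Num.sqrt (edge_form p (X t) * edge_form q (Y t))).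
Proof.
move=> m0 m'0 dX dY.
have mm0 : 0 < edge_form p (X t) * edge_form q (Y t) by rewrite mulr_gt0.
pose M z := edge_form p (X z) * edge_form q (Y z).
have dM : is_derive t 1 M
   ((2 * X t + 2 * p) * dx * edge_form q (Y t) +
    (2 * Y t + 2 * q) * dy * edge_form p (X t)).
  have d := is_deriveM (is_derive_edge_form p dX) (is_derive_edge_form q dY).
  by apply: (is_derive_eq d); rewrite /GRing.scale/=; ring.
have dN : is_derive t 1 (fun z => cos_num p q s (X z) (Y z))
   (dx * (Y t + q) + dy * (X t + p)).
  have d := is_derive_mul_shift p q (- s - p * q) dX dY.
  rewrite (_ : (fun z => _) = fun z => (X z + p) * (Y z + q) + (- s - p * q)).
    by apply: (is_derive_eq d); ring.
  by apply/funext => z; rewrite /cos_num; ring.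
have dS : is_derive t 1 (Num.sqrt \o M) ((2 * Num.sqrt (M t))^-1 *
   ((2 * X t + 2 * p) * dx * edge_form q (Y t) +
    (2 * Y t + 2 * q) * dy * edge_form p (X t))).
  have dsq : is_derive (M t) 1 Num.sqrt (2 * Num.sqrt (M t))^-1.
    exact: is_derive1_sqrt mm0.
  exact: (is_derive1_comp dsq dM).
have S0 : (Num.sqrt \o M) t != 0 by rewrite lt0r_neq0// sqrtr_gt0.
have dV := is_deriveV S0 dS.
apply: (is_derive_eq (is_deriveM dN dV)).
rewrite /GRing.scale/= -/(M t); rewrite /= in S0.
have SE : Num.sqrt (M t) ^+ 2 = edge_form p (X t) * edge_form q (Y t).
  by rewrite sqr_sqrtr// ltW.
move: S0 SE; set S := Num.sqrt (M t) => S0 SE.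
have m_neq0 := lt0r_neq0 m0; have m'_neq0 := lt0r_neq0 m'0.
(* The heights are the numerators produced by the quotient rule. *)
have hX : height p q s (X t) (Y t) = (Y t + q) * edge_form p (X t) -
    cos_num p q s (X t) (Y t) * (X t + p).
  by rewrite /height /edge_form /cos_num; ring.
have hY : height q p s (Y t) (X t) = (X t + p) * edge_form q (Y t) -
    cos_num p q s (X t) (Y t) * (Y t + q).
  by rewrite /height /edge_form /cos_num; ring.
set K := _ + _ * edge_form p (X t); set L := _ + dy * (X t + p).
transitivity ((L - cos_num p q s (X t) (Y t) * K / (2 * S ^+ 2)) / S).
  by field.
by rewrite SE hX hY /K /L; congr (_ / _); field; apply/andP.
Qed.

(** By [face_cos_sqr] the root dividing the derivative of the cosine cancels against the denominator
    of sqrt (1 - cos^2), leaving sqrt [gram]. *)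
Lemma is_derive_face_angle p q s (X Y : R -> R) (t dx dy : R) :
  0 < edge_form p (X t) -> 0 < edge_form q (Y t) ->
  0 < gram p q s (X t) (Y t) ->
  is_derive t 1 X dx -> is_derive t 1 Y dy ->
  is_derive t 1 (fun z => acos (face_cos p q s (X z) (Y z)))
    (- (dx * height p q s (X t) (Y t) / edge_form p (X t) +
        dy * height q p s (Y t) (X t) / edge_form q (Y t))
     / Num.sqrt (gram p q s (X t) (Y t))).
Proof.
move=> m0 m'0 Q0 dX dY.
have mm0 : 0 < edge_form p (X t) * edge_form q (Y t) by rewrite mulr_gt0.
have dC := is_derive_face_cos s m0 m'0 dX dY.
have itv : -1 < face_cos p q s (X t) (Y t) < 1.
  have : face_cos p q s (X t) (Y t) ^+ 2 < 1.
    by rewrite -subr_gt0 face_cos_sqr// divr_gt0.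
  by rewrite -ltr_norml -real_normK ?num_real// expr_lt1.
have dA := @is_derive1_comp R acos (fun z => face_cos p q s (X z) (Y z)) t
  _ _ (is_derive1_acos itv) dC.
apply: (is_derive_eq dA).
rewrite face_cos_sqr// sqrtrM ?(ltW Q0)// sqrtrV ?(ltW mm0)//.
have S0 := mm0; rewrite -sqrtr_gt0 in S0.
have G0 := Q0; rewrite -sqrtr_gt0 in G0.
have {}S0 := lt0r_neq0 S0; have {}G0 := lt0r_neq0 G0.
move: S0 G0; set S := Num.sqrt (_ * _); set G := Num.sqrt _ => S0 G0.
have m_neq0 := lt0r_neq0 m0; have m'_neq0 := lt0r_neq0 m'0.
by field; do ?[apply/andP; split].
Qed.

Lemma within_continuous_face_angle p q s (X Y dx dy : R -> R)
    (A : set R) :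
  (forall t, A t -> [/\ 0 < edge_form p (X t), 0 < edge_form q (Y t) &
                       0 <= gram p q s (X t) (Y t)]) ->
  (forall t : R, is_derive t 1 X (dx t)) ->
  (forall t : R, is_derive t 1 Y (dy t)) ->
  {within A, continuous (fun z => acos (face_cos p q s (X z) (Y z)))}.
Proof.
move=> h dX dY.
refine (@within_continuous_comp_within R R R A `[-1, 1]%classic
  (fun z => face_cos p q s (X z) (Y z)) (@acos R) _ _ _).
- apply: continuous_in_subspaceT => t /set_mem /h[m0 m'0 _].
  have [dC _] := is_derive_face_cos s m0 m'0 (dX t) (dY t).
  exact/differentiable_continuous/derivable1_diffP.
- exact: within_continuous_acos.
- by move=> _ [t /h[m0 m'0 Q0] <-] /=; rewrite in_itv/= face_cos_itv.
Qed.

End Angle.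

(** * Rigidity of the star in the coordinates x_i = r_0 / r_i *)

Section Star.
Variables (R : realType) (n : nat) (p s : 'I_n -> R).
Hypothesis fw : forall i, face_weights (p i) (p (ordS i)) (s i).

Let fw' i : face_weights (p i) (p (ord_pred i)) (s (ord_pred i)).
Proof. by apply: face_weightsC; have := fw (ord_pred i); rewrite ord_predK. Qed.

Let D i := discr (p i) (p (ordS i)) (s i).
Let D' i := discr (p i) (p (ord_pred i)) (s (ord_pred i)).

(** The linear part of the affine function [slope] below. *)
Definition tilt (e : 'I_n -> R) i : R :=
  (e (ordS i) * (1 - p i ^+ 2) + e i * (s i + p i * p (ordS i)))
    / Num.sqrt (D i) +
  (e (ord_pred i) * (1 - p i ^+ 2) +
     e i * (s (ord_pred i) + p i * p (ord_pred i))) / Num.sqrt (D' i).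

(** Discrete maximum principle: where e_i / sqrt (p_i^2 - 1) is maximal on the support of e,
    [tilt_ge0] makes both summands of [tilt] nonnegative and one of them positive. *)
Lemma tilt_rigidity (e : 'I_n -> R) : (forall i, 0 <= e i) ->
  (forall i, e i != 0 -> [/\ 1 < p i, tilt e i = 0 &
     s i + p i * p (ordS i) != 0 \/
     s (ord_pred i) + p i * p (ord_pred i) != 0]) ->
  forall i, e i = 0.
Proof.
move=> e0 he i0; apply/eqP/negPn/negP => ei0.
have := @arg_maxP _ R _ i0 (fun i => e i != 0)
  (fun i => e i / Num.sqrt (p i ^+ 2 - 1)) ei0.
case=> i /= ei imax; have [p1 ti g] := he i ei.
have ei_gt0 : 0 < e i by rewrite lt0r ei e0.
have next j : e j != 0 -> 1 < p j /\
    e j / Num.sqrt (p j ^+ 2 - 1) <= e i / Num.sqrt (p i ^+ 2 - 1).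
  by move=> ej; have [pj _ _] := he j ej; split=> //; exact: imax.
have [t1 t1'] := tilt_ge0 (fw i) p1 ei_gt0 (e0 _) (next (ordS i)).
have [t2 t2'] := tilt_ge0 (fw' i) p1 ei_gt0 (e0 _) (next (ord_pred i)).
have D0 : 0 < Num.sqrt (D i) by rewrite sqrtr_gt0; exact: discr_gt0 (fw i) p1.
have D'0 : 0 < Num.sqrt (D' i).
  by rewrite sqrtr_gt0; exact: discr_gt0 (fw' i) p1.
suff : 0 < tilt e i by rewrite ti ltxx.
case: g => g; [apply: ltr_pwDl|apply: ltr_wpDl].
- by rewrite divr_gt0// t1'.
- by rewrite divr_ge0// ltW.
- by rewrite divr_ge0// ltW.
- by rewrite divr_gt0// t2'.
Qed.

(** Left side of the linear Delaunay inequality at v_0 v_i; affine in x because [D] and [D'] depend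
    on the weights alone. *)
Definition slope (x : 'I_n -> R) i : R :=
  height (p i) (p (ordS i)) (s i) (x i) (x (ordS i)) / Num.sqrt (D i) +
  height (p i) (p (ord_pred i)) (s (ord_pred i)) (x i) (x (ord_pred i))
    / Num.sqrt (D' i).

Definition total_angle (x : 'I_n -> R) : R :=
  \sum_(i < n) acos (face_cos (p i) (p (ordS i)) (s i) (x i) (x (ordS i))).

Let G (x : 'I_n -> R) i := gram (p i) (p (ordS i)) (s i) (x i) (x (ordS i)).
Let G' (x : 'I_n -> R) i :=
  gram (p i) (p (ord_pred i)) (s (ord_pred i)) (x i) (x (ord_pred i)).
Let m (x : 'I_n -> R) i := edge_form (p i) (x i).

(* This is - m x i times the partial derivative of total_angle in x_i. *)
Let grad (x : 'I_n -> R) i : R :=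
  height (p i) (p (ordS i)) (s i) (x i) (x (ordS i)) / Num.sqrt (G x i) +
  height (p i) (p (ord_pred i)) (s (ord_pred i)) (x i) (x (ord_pred i))
    / Num.sqrt (G' x i).

Let G'E x i : G' x i = G x (ord_pred i).
Proof. by rewrite /G' /G gramC ord_predK. Qed.

Let p_gtN1 i : -1 < p i. Proof. by case: (fw i) => -[]. Qed.

Let heightN (q1 q2 q3 x y : R) : (q1 ^+ 2 - 1) * gram q1 q2 q3 x y =
  edge_form q1 x * discr q1 q2 q3 - height q1 q2 q3 x y ^+ 2.
Proof. by rewrite height_sqr; ring. Qed.

(** [sum_div_sqrt_ge0] with m = [edge_form] and c = p_i^2 - 1: the sign of a partial derivative of
    the angle becomes that of an affine function. *)
Lemma slope_grad x i : 1 < p i -> 0 < x i -> 0 < G x i -> 0 < G' x i ->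
  ((0 <= slope x i) = (0 <= grad x i)) *
  ((slope x i <= 0) = (grad x i <= 0)).
Proof.
move=> p1 x0 G0 G'0.
have D0 := discr_gt0 (fw i) p1; have D'0 := discr_gt0 (fw' i) p1.
have m0 := edge_form_gt0 (p_gtN1 i) x0.
have k0 : 0 < p i ^+ 2 - 1 by rewrite subr_gt0 expr_gt1//; lra.
split.
  exact: (sum_div_sqrt_ge0 D0 D'0 G0 G'0 m0 k0 (heightN _ _ _ _ _)
    (heightN _ _ _ _ _)).
rewrite -oppr_ge0 -[RHS]oppr_ge0 /slope /grad !opprD -!mulNr.
by apply: (sum_div_sqrt_ge0 D0 D'0 G0 G'0 m0 k0); rewrite sqrrN heightN.
Qed.

Variables (x xb : 'I_n -> R).
Hypotheses (x_gt0 : forall i, 0 < x i) (xb_gt0 : forall i, 0 < xb i).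
Hypotheses (xb_le : forall i, xb i <= x i).
Hypotheses (Gx : forall i, 0 <= G x i) (Gxb : forall i, 0 <= G xb i).
Hypotheses (slope_x : forall i, 1 < p i -> 0 <= slope x i)
  (slope_xb : forall i, 1 < p i -> 0 <= slope xb i).
Hypothesis regular : forall i, ~ [/\ p i = 1,
  p (ord_pred i) = - s (ord_pred i) & p (ordS i) = - s i].
Hypothesis angle_le : total_angle xb <= total_angle x.

(** The segment starts at [x] for t = 0 and ends at [xb] for t = 1, so its velocity is -e. *)
Let X i (t : R) : R := (1 - t) * x i + t * xb i.
Let e i := x i - xb i.

Let e_ge0 i : 0 <= e i. Proof. by rewrite subr_ge0. Qed.

Let X_gt0 i (t : R) : 0 <= t <= 1 -> 0 < X i t.
Proof.
move=> /andP[t0 t1]; rewrite /X.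
have -> : (1 - t) * x i + t * xb i = xb i + (1 - t) * e i by rewrite /e; ring.
by rewrite ltr_pwDl// mulr_ge0// subr_ge0.
Qed.

Let is_derive_X i (t : R) : is_derive t 1 (X i) (- e i).
Proof.
rewrite (_ : X i = (- e i) *: id + cst (x i)); last first.
  by apply/funext => z; rewrite /X /e !fctE /GRing.scale/=; ring.
by apply: is_derive_eq; rewrite /GRing.scale/=; ring.
Qed.

Let face_moves i : (e i != 0) || (e (ordS i) != 0) =
  ((x i, x (ordS i)) != (xb i, xb (ordS i))).
Proof. by rewrite xpair_eqE negb_and !subr_eq0. Qed.

Let G_gt0 (t : R) i : 0 < t < 1 -> (e i != 0) || (e (ordS i) != 0) ->
  0 < G (X ^~ t) i.
Proof.
move=> t01; rewrite face_moves => ne.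
exact: (gram_segment_gt0 (fw i) (x_gt0 _) (x_gt0 _) (xb_gt0 _) (xb_gt0 _)
  (Gx i) (Gxb i)).
Qed.

Let G_ge0 (t : R) i : 0 <= t <= 1 -> 0 <= G (X ^~ t) i.
Proof.
move=> /andP[t0 t1]; have [t01|] := boolP (0 < t < 1).
  have [|] := boolP ((e i != 0) || (e (ordS i) != 0)).
    by move=> h; apply/ltW/G_gt0.
  rewrite negb_or !negbK !subr_eq0 => /andP[/eqP e1 /eqP e2].
  have -> : G (X^~ t) i = G x i by rewrite /G /X -e1 -e2; congr gram; ring.
  exact: Gx.
rewrite negb_and -!leNgt => /orP[t_le0|t_ge1].
  have -> : t = 0 by apply/eqP; rewrite eq_le t_le0.
  have -> : G (X^~ 0) i = G x i by rewrite /G /X; congr gram; ring.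
  exact: Gx.
have -> : t = 1 by apply/eqP; rewrite eq_le t1.
have -> : G (X^~ 1) i = G xb i by rewrite /G /X; congr gram; ring.
exact: Gxb.
Qed.

Let alpha i (t : R) : R :=
  acos (face_cos (p i) (p (ordS i)) (s i) (X i t) (X (ordS i) t)).

Let dalpha i (t : R) : R :=
  - (- e i * height (p i) (p (ordS i)) (s i) (X i t) (X (ordS i) t)
        / m (X ^~ t) i +
     - e (ordS i) * height (p (ordS i)) (p i) (s i) (X (ordS i) t) (X i t)
        / m (X ^~ t) (ordS i)) / Num.sqrt (G (X ^~ t) i).

Let is_derive_alpha i (t : R) : 0 < t < 1 ->
  is_derive t 1 (alpha i) (dalpha i t).
Proof.
move=> t01; have t01' : 0 <= t <= 1 by case/andP: t01 => /ltW -> /ltW ->.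
have m0 j : 0 < m (X ^~ t) j by apply: edge_form_gt0 => //; exact: X_gt0.
have [h|] := boolP ((e i != 0) || (e (ordS i) != 0)).
  exact: is_derive_face_angle (m0 _) (m0 _) (G_gt0 t01 h) (is_derive_X _ _)
    (is_derive_X _ _).
rewrite negb_or !negbK => /andP[/eqP e1 /eqP e2].
have XE j z : e j = 0 -> X j z = x j.
  have -> : X j z = x j - z * e j by rewrite /X /e; ring.
  by move=> ->; rewrite mulr0 subr0.
(* A face that does not move may be degenerate; its angle is constant, and [dalpha] is 0 even if [G]
   vanishes, since its numerator does. *)
rewrite /dalpha e1 e2 oppr0 !mul0r addr0 oppr0 mul0r.
rewrite (_ : alpha i =
  cst (acos (face_cos (p i) (p (ordS i)) (s i) (x i) (x (ordS i))))).
  exact: is_derive_cst.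
by apply/funext => z; rewrite /alpha !XE.
Qed.

(** Regrouping from faces to vertices: the second term of face i is moved to the vertex [ordS i]. *)
Let sum_dalpha (t : R) : \sum_(i < n) dalpha i t =
  \sum_(i < n) e i / m (X ^~ t) i * grad (X ^~ t) i.
Proof.
pose f i := e i / m (X ^~ t) i *
  (height (p i) (p (ordS i)) (s i) (X i t) (X (ordS i) t)
     / Num.sqrt (G (X ^~ t) i)).
pose g i := e i / m (X ^~ t) i *
  (height (p i) (p (ord_pred i)) (s (ord_pred i)) (X i t) (X (ord_pred i) t)
     / Num.sqrt (G' (X ^~ t) i)).
transitivity (\sum_i f i + \sum_i g i); last first.
  by rewrite -big_split; apply: eq_bigr => i _; rewrite /grad mulrDr.
rewrite [\sum_i g i](reindex_inj (@ordS_inj n)) -big_split.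
apply: eq_bigr => i _; rewrite /dalpha /f /g G'E ordSK /=; ring.
Qed.

Lemma star_rigidity i : x i = xb i.
Proof.
suff /(_ i)/eqP : forall i, e i = 0 by rewrite subr_eq0 => /eqP.
have cont : {within `[0, 1]%classic, continuous (\sum_(j < n) alpha j)}.
  elim/big_ind: _ => [|f g cf cg|j _].
  - by apply: continuous_subspaceT => z; exact: cst_continuous.
  - by move=> z; apply: continuousD; [exact: cf|exact: cg].
  - apply: (within_continuous_face_angle _ (is_derive_X j) (is_derive_X _)).
    move=> t /=; rewrite in_itv/= => t01.
    split; [| |exact: G_ge0]; apply: edge_form_gt0 => //; exact: X_gt0.
have deriv (t : R) : t \in `]0, 1[%R ->
    is_derive t 1 (\sum_(j < n) alpha j) (\sum_(j < n) dalpha j t).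
  by rewrite in_itv/= => t01; apply: is_derive_sum => j; exact: is_derive_alpha.
(* Only continuity is available at the ends of the segment, where moving faces may be degenerate. *)
have [c] := MVT ltr01 deriv cont.
rewrite in_itv/= subr0 mulr1 !fct_sumE => c01.
have -> : \sum_(j < n) alpha j 1 = total_angle xb.
  apply: eq_bigr => j _; rewrite /alpha /X.
  by congr (acos (face_cos _ _ _ _ _)); ring.
have -> : \sum_(j < n) alpha j 0 = total_angle x.
  apply: eq_bigr => j _; rewrite /alpha /X.
  by congr (acos (face_cos _ _ _ _ _)); ring.
rewrite sum_dalpha => mvt.
have c01' : 0 <= c <= 1 by case/andP: c01 => /ltW -> /ltW ->.
have m0 j : 0 < m (X ^~ c) j by apply: edge_form_gt0 => //; exact: X_gt0.
have slopeE j : slope (X ^~ c) j = (1 - c) * slope x j + c * slope xb j.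
  by rewrite /slope /height /X; ring.
have GG j : e j != 0 -> 0 < G (X ^~ c) j /\ 0 < G' (X ^~ c) j.
  move=> ej; rewrite G'E !G_gt0 ?ej ?orbT//.
  by rewrite ord_predK ej orbT.
have XX j : 0 < X j c by exact: X_gt0.
(* For p_j <= 1 both heights are nonnegative; for p_j > 1 the sign is that of [slope], nonnegative
   at both ends of the segment. *)
have grad_ge0 j : e j != 0 -> 0 <= grad (X ^~ c) j.
  move=> ej; have [G0 G'0] := GG j ej.
  have [pj|pj] := leP (p j) 1.
    by rewrite addr_ge0// divr_ge0 ?sqrtr_ge0// height_ge0.
  rewrite -slope_grad// slopeE addr_ge0// mulr_ge0 ?slope_x ?slope_xb//.
    by rewrite subr_ge0; case/andP: c01'.
  by case/andP: c01'.
have term_ge0 j : 0 <= e j / m (X ^~ c) j * grad (X ^~ c) j.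
  have [->|ej] := eqVneq (e j) 0; first by rewrite !mul0r.
  by rewrite mulr_ge0 ?grad_ge0// divr_ge0// ltW.
have grad_eq0 j : e j != 0 -> grad (X ^~ c) j = 0.
  move=> ej; have S0 : \sum_(j < n) e j / m (X ^~ c) j * grad (X ^~ c) j = 0.
    (* The sum equals the change of total angle from [x] to [xb], which is at most 0, while every
       term is at least 0. *)
    apply/eqP; rewrite eq_le sumr_ge0// andbT -mvt subr_le0; exact: angle_le.
  have /eqP : e j / m (X ^~ c) j * grad (X ^~ c) j = 0.
    exact: (psumr_eq0P (fun k _ => term_ge0 k) S0).
  by rewrite mulf_eq0 mulf_eq0 invr_eq0 (gt_eqF (m0 j)) (negbTE ej) => /eqP.
apply: tilt_rigidity => // j ej.
have [G0 G'0] := GG j ej; have g0 := grad_eq0 j ej.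
have [pj|pj] := leP (p j) 1.
  (* For p_j <= 1 the heights of both adjacent faces vanish, which is the configuration excluded by
     regularity. *)
  exfalso; move/eqP: g0; rewrite paddr_eq0.
  - rewrite !mulf_eq0 !invr_eq0 !sqrtr_eq0 !leNgt G0 G'0 !orbF.
    move=> /andP[/eqP h1 /eqP h2].
    have [p1 e1] := height_eq0 (fw j) pj (XX _) (XX _) h1.
    have [_ e2] := height_eq0 (fw' j) pj (XX _) (XX _) h2.
    exact: (regular (i := j)).
  - by rewrite divr_ge0 ?sqrtr_ge0// height_ge0.
  - by rewrite divr_ge0 ?sqrtr_ge0// height_ge0.
have sX0 : slope (X ^~ c) j = 0.
  by apply/eqP; rewrite eq_le !slope_grad// g0 lexx.
have [c0 c1] : 0 < c /\ 0 < 1 - c by case/andP: c01; rewrite subr_gt0.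
(* As 0 < c < 1, the vanishing of [slope] at c forces it to vanish at both ends. *)
move: sX0; rewrite slopeE => /eqP; rewrite paddr_eq0; last 2 first.
- by rewrite mulr_ge0 ?slope_x// ltW.
- by rewrite mulr_ge0 ?slope_xb// ltW.
rewrite !mulf_eq0 (gt_eqF c0) (gt_eqF c1)/= => /andP[/eqP s1 /eqP s2].
split=> //.
  have -> : tilt e j = slope x j - slope xb j.
    by rewrite /tilt /slope /height /e; ring.
  by rewrite s1 s2 subrr.
(* If both structure terms vanished, both heights at [x] would be negative, and so would
   [slope x j], which is 0. *)
apply/orP; rewrite -negb_and; apply/negP => /andP[/eqP g1 /eqP g2].
suff : slope x j < 0 by rewrite s1 ltxx.
rewrite -[ltRHS]addr0; apply: ltrD; rewrite pmulr_llt0 ?invr_gt0 ?sqrtr_gt0.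
- by apply: height_lt0 => //; case: (fw j) => _ [_ [[]|[]]] //; lra.
- exact: discr_gt0 (fw j) pj.
- by apply: height_lt0 => //; case: (fw' j) => _ [_ [[]|[]]] //; lra.
- exact: discr_gt0 (fw' j) pj.
Qed.

End Star.

Local Close Scope classical_set_scope.

(** * Lengths, angles and geometric center of one face, in terms of the algebraic quantities *)

Section FaceGeometry.
Variables (R : realType) (n : nat) (I : vertex n -> vertex n -> R).
Variables (r : vertex n -> R) (o u v : vertex n).
Hypotheses (r0 : forall x, 0 < r x).
Hypotheses (Iuo : I u o = I o u) (Ivo : I v o = I o v) (Ivu : I v u = I u v).
Hypothesis fw : face_weights (I o u) (I o v) (I u v).
Hypotheses (tri_ou : len I r o u <= len I r o v + len I r u v)
  (tri_ov : len I r o v <= len I r o u + len I r u v)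
  (tri_uv : len I r u v <= len I r o u + len I r o v).

Let p := I o u.
Let q := I o v.
Let s := I u v.
Let x := r o / r u.
Let y := r o / r v.
Let a := len I r o u.
Let b := len I r o v.
Let c := len I r u v.

Let p1 : -1 < p. Proof. by case: fw => -[]. Qed.
Let q1 : -1 < q. Proof. by case: fw => -[]. Qed.
Let s1 : -1 < s. Proof. by case: fw => -[]. Qed.
Let ru0 : r u != 0. Proof. exact: lt0r_neq0. Qed.
Let rv0 : r v != 0. Proof. exact: lt0r_neq0. Qed.

Lemma lenC w z : I w z = I z w -> len I r w z = len I r z w.
Proof. by rewrite /len => ->; congr Num.sqrt; ring. Qed.

Let len_sqr_gt0 (k : R) w z : -1 < k ->
  0 < r w ^+ 2 + r z ^+ 2 + 2 * r w * r z * k.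
Proof.
move=> k1; have -> : r w ^+ 2 + r z ^+ 2 + 2 * r w * r z * k =
  (r w - r z) ^+ 2 + 2 * (r w * r z * (1 + k)) by ring.
by rewrite ltr_wpDl ?sqr_ge0// !mulr_gt0//; lra.
Qed.

Let a0 : 0 < a. Proof. by rewrite sqrtr_gt0 len_sqr_gt0. Qed.
Let b0 : 0 < b. Proof. by rewrite sqrtr_gt0 len_sqr_gt0. Qed.
Let c0 : 0 < c. Proof. by rewrite sqrtr_gt0 len_sqr_gt0. Qed.
Let a_sqr : a ^+ 2 = r o ^+ 2 + r u ^+ 2 + 2 * r o * r u * p.
Proof. by rewrite sqr_sqrtr// ltW// len_sqr_gt0. Qed.
Let b_sqr : b ^+ 2 = r o ^+ 2 + r v ^+ 2 + 2 * r o * r v * q.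
Proof. by rewrite sqr_sqrtr// ltW// len_sqr_gt0. Qed.
Let c_sqr : c ^+ 2 = r u ^+ 2 + r v ^+ 2 + 2 * r u * r v * s.
Proof. by rewrite sqr_sqrtr// ltW// len_sqr_gt0. Qed.

Let a_sqrE : a ^+ 2 = r u ^+ 2 * edge_form p x.
Proof. by rewrite a_sqr /edge_form /x; field. Qed.
Let b_sqrE : b ^+ 2 = r v ^+ 2 * edge_form q y.
Proof. by rewrite b_sqr /edge_form /y; field. Qed.
Let cosE : (a ^+ 2 + b ^+ 2 - c ^+ 2) / 2 = r u * r v * cos_num p q s x y.
Proof. by rewrite a_sqr b_sqr c_sqr /cos_num /x /y; field; apply/andP. Qed.

Let gramE : (r u * r v) ^+ 2 * gram p q s x y =
  a ^+ 2 * b ^+ 2 - ((a ^+ 2 + b ^+ 2 - c ^+ 2) / 2) ^+ 2.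
Proof. by rewrite cosE a_sqrE b_sqrE /gram; ring. Qed.

Let heron : a ^+ 2 * b ^+ 2 - ((a ^+ 2 + b ^+ 2 - c ^+ 2) / 2) ^+ 2 =
  (a + b + c) * ((a + b - c) * (c + a - b) * (c + b - a)) / 4.
Proof. by field. Qed.

Let ruv2 : 0 < (r u * r v) ^+ 2. Proof. by rewrite exprn_gt0// mulr_gt0. Qed.

Lemma face_gram_ge0 : 0 <= gram p q s x y.
Proof.
rewrite -(pmulr_rge0 _ ruv2) gramE heron divr_ge0// mulr_ge0//.
  by rewrite !addr_ge0// ltW.
by rewrite !mulr_ge0//; move: tri_ou tri_ov tri_uv; rewrite -/a -/b -/c; lra.
Qed.

Let len_uo : len I r u o = a. Proof. exact: lenC. Qed.
Let len_vo : len I r v o = b. Proof. exact: lenC. Qed.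
Let len_vu : len I r v u = c. Proof. exact: lenC. Qed.

(** Heron's formula: apart from the positive perimeter, each factor vanishes exactly when one vertex
    is flat. *)
Lemma face_gram_eq0 : (gram p q s x y == 0) =
  [|| flat I r u v o, flat I r o v u | flat I r o u v].
Proof.
rewrite /flat len_uo len_vo len_vu -/a -/b -/c.
rewrite -(inj_eq (mulfI (lt0r_neq0 ruv2))) mulr0 gramE heron.
rewrite !mulf_eq0 invr_eq0 (gt_eqF (addr_gt0 (addr_gt0 a0 b0) c0))/=.
rewrite [4 == 0]pnatr_eq0/= orbF -orbA; congr [|| _, _ | _].
- by rewrite subr_eq0 eq_sym.
- by rewrite subr_eq0 eq_sym addrC.
- by rewrite subr_eq0 eq_sym addrC.
Qed.

(** The conventions for degenerate faces agree with acos, since the cosine is -1 or 1 there. *)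
Lemma face_angle : angle I r o u v = acos (face_cos p q s x y).
Proof.
have lenE : a * b = r u * r v * Num.sqrt (edge_form p x * edge_form q y).
  have ab0 : 0 <= a * b by rewrite mulr_ge0// ltW.
  have m0 : 0 < edge_form p x * edge_form q y.
    by rewrite mulr_gt0// edge_form_gt0// divr_gt0.
  apply/eqP; rewrite -(@eqrXn2 _ 2)//; last first.
    by rewrite mulr_ge0 ?sqrtr_ge0// mulr_ge0// ltW.
  by rewrite !exprMn (sqr_sqrtr (ltW m0)) a_sqrE b_sqrE; apply/eqP; ring.
have ab0 : a * b != 0 by rewrite mulf_neq0// lt0r_neq0.
have ruv0 : r u * r v != 0 by rewrite mulf_neq0.
have fcE : face_cos p q s x y = (a ^+ 2 + b ^+ 2 - c ^+ 2) / (2 * a * b).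
  have -> : (a ^+ 2 + b ^+ 2 - c ^+ 2) / (2 * a * b) =
     (a ^+ 2 + b ^+ 2 - c ^+ 2) / 2 / (a * b).
    by field; rewrite !lt0r_neq0.
  by rewrite cosE lenE /face_cos invfM mulrACA divff// mul1r.
rewrite /angle /flat len_uo len_vo len_vu -/a -/b -/c.
case: eqP => [cE|_].
  rewrite fcE [X in acos X](_ : _ = - 1) ?acosN1// cE.
  by field; rewrite !lt0r_neq0.
case: orP => [[]/eqP e|_]; last by rewrite fcE.
- rewrite fcE [X in acos X](_ : _ = 1) ?acos1// e.
  by field; rewrite -?e !lt0r_neq0.
- rewrite fcE [X in acos X](_ : _ = 1) ?acos1// e.
  by field; rewrite -?e !lt0r_neq0.
Qed.

Let dot := (a ^+ 2 + b ^+ 2 - c ^+ 2) / 2.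

Let heightE : r o * r u ^+ 2 * r v * height p q s x y =
  (a ^+ 2 * (b ^+ 2 + r o ^+ 2 - r v ^+ 2)
   - dot * (a ^+ 2 + r o ^+ 2 - r u ^+ 2)) / 2.
Proof.
rewrite /dot a_sqr b_sqr c_sqr /height /x /y.
by field; apply/andP.
Qed.

Let edist_sqr (A B : R * R) (k : R) : 0 <= k ->
  Defs.edist A B = k <-> (B.1 - A.1) ^+ 2 + (B.2 - A.2) ^+ 2 = k ^+ 2.
Proof.
move=> k0; split=> [<-|e]; first by rewrite sqr_sqrtr// addr_ge0 ?sqr_ge0.
by rewrite /Defs.edist e sqrtr_sqr ger0_norm.
Qed.

Let gramD : (r u * r v) ^+ 2 * gram p q s x y = a ^+ 2 * b ^+ 2 - dot ^+ 2.
Proof. exact: gramE. Qed.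

(** In any placement the product of the cross products of C and of P relative to AB depends only on
    lengths and radii, which fixes the signed distance. *)
Lemma face_edge_h : 0 < gram p q s x y ->
  edge_h I r o u v =
  r o * r u * height p q s x y / (a * Num.sqrt (gram p q s x y)).
Proof.
move=> Q0; set g := Num.sqrt _.
have g0 : 0 < g by rewrite sqrtr_gt0.
have gg : g ^+ 2 = gram p q s x y by rewrite sqr_sqrtr// ltW.
rewrite /edge_h; case: xgetP => [h _ [A [B [C [P [[AB AC BC] [G1 G2] ->]]]]]|].
  have U2 := (edist_sqr _ _ (ltW a0)).1 AB.
  have V2 := (edist_sqr _ _ (ltW b0)).1 AC.
  have W2 := (edist_sqr _ _ (ltW c0)).1 BC.
  have E2 X Y : Defs.edist X Y ^+ 2 = (Y.1 - X.1) ^+ 2 + (Y.2 - X.2) ^+ 2.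
    by rewrite sqr_sqrtr// addr_ge0 ?sqr_ge0.
  move: G1 G2; rewrite !E2 => G1 G2.
  have dotE : (B.1 - A.1) * (C.1 - A.1) + (B.2 - A.2) * (C.2 - A.2) = dot.
    by rewrite /dot -U2 -V2 -W2; field.
  (* Equality of the powers of P turns into the inner products of P - A with the two sides at A. *)
  have UP : (B.1 - A.1) * (P.1 - A.1) + (B.2 - A.2) * (P.2 - A.2) =
     (a ^+ 2 + r o ^+ 2 - r u ^+ 2) / 2.
    by apply: (@mulIf _ 2) => //; rewrite divfK// -U2; lra.
  have VP : (C.1 - A.1) * (P.1 - A.1) + (C.2 - A.2) * (P.2 - A.2) =
     (b ^+ 2 + r o ^+ 2 - r v ^+ 2) / 2.
    by apply: (@mulIf _ 2) => //; rewrite divfK// -V2; lra.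
  have crE : cross A B C ^+ 2 = (r u * r v * g) ^+ 2.
    by rewrite exprMn gg gramD -dotE -U2 -V2 /cross; ring.
  have crP : cross A B C * cross A B P =
      r o * r u ^+ 2 * r v * height p q s x y.
    have -> : r o * r u ^+ 2 * r v * height p q s x y =
        a ^+ 2 * ((b ^+ 2 + r o ^+ 2 - r v ^+ 2) / 2)
        - dot * ((a ^+ 2 + r o ^+ 2 - r u ^+ 2) / 2) by rewrite heightE; field.
    by rewrite -UP -VP -dotE -U2 /cross; ring.
  have nrm : `|cross A B C| = r u * r v * g.
    have k0 : 0 <= r u * r v * g by rewrite !mulr_ge0// ltW.
    by apply/eqP; rewrite -(@eqrXn2 _ 2)// real_normK ?num_real// crE.
  rewrite /signed_dist AB mulrA.
  have cr0 : cross A B C != 0 by rewrite -normr_gt0 nrm !mulr_gt0.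
  have -> : Num.sg (cross A B C) = cross A B C / `|cross A B C|.
    by rewrite {2}[cross A B C]numEsg mulfK// normr_eq0.
  rewrite -[len I r o u]/a nrm.
  rewrite [cross A B C / _ * _]mulrAC crP.
  by field; rewrite ru0 rv0 !lt0r_neq0.
have D0 : 0 < a ^+ 2 * b ^+ 2 - dot ^+ 2 by rewrite -gramD mulr_gt0.
set z := Num.sqrt (a ^+ 2 * b ^+ 2 - dot ^+ 2).
have z0 : 0 < z by rewrite sqrtr_gt0.
have zz : z ^+ 2 = a ^+ 2 * b ^+ 2 - dot ^+ 2 by rewrite sqr_sqrtr// ltW.
have a_neq0 := lt0r_neq0 a0; have z_neq0 := lt0r_neq0 z0.
(* The set defining [edge_h] is not empty: with A at the origin and B on the first axis, (w1, w2)
   solves the two linear equations of the center. *)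
pose w1 := (a ^+ 2 + r o ^+ 2 - r u ^+ 2) / (2 * a).
pose w2 := (a * ((b ^+ 2 + r o ^+ 2 - r v ^+ 2) / 2) - dot * w1) / z.
have e3 : (dot / a) ^+ 2 + (z / a) ^+ 2 = b ^+ 2.
  have -> : (dot / a) ^+ 2 + (z / a) ^+ 2 = (dot ^+ 2 + z ^+ 2) / a ^+ 2.
    by field.
  by rewrite zz; field.
move=> none; exfalso.
apply: (none (signed_dist (0, 0) (a, 0) (dot / a, z / a) (w1, w2))).
exists (0, 0), (a, 0), (dot / a, z / a), (w1, w2).
split=> //.
  split.
  - by apply/edist_sqr => /=; [exact: ltW | rewrite -/a; ring].
  - apply/edist_sqr => /=; first exact: ltW.
    by rewrite -/b !subr0 e3.
  - apply/edist_sqr => /=; first exact: ltW.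
    rewrite -/c.
    have -> : (dot / a - a) ^+ 2 + (z / a - 0) ^+ 2 =
       (dot ^+ 2 + z ^+ 2) / a ^+ 2 - 2 * dot + a ^+ 2 by field.
    by rewrite zz /dot; field.
have E2 X Y : Defs.edist X Y ^+ 2 = (Y.1 - X.1) ^+ 2 + (Y.2 - X.2) ^+ 2.
  by rewrite sqr_sqrtr// addr_ge0 ?sqr_ge0.
have e1 : 2 * a * w1 = a ^+ 2 + r o ^+ 2 - r u ^+ 2 by rewrite /w1; field.
have e2 : 2 * (dot / a * w1 + z / a * w2) = b ^+ 2 + r o ^+ 2 - r v ^+ 2.
  by rewrite /w2; field; apply/andP.
rewrite /geometric_center !E2/= !sub0r; split.
  apply/eqP; rewrite -subr_eq0; apply/eqP.
  transitivity (2 * a * w1 - (a ^+ 2 + r o ^+ 2 - r u ^+ 2)); first by ring.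
  by rewrite e1 subrr.
apply/eqP; rewrite -subr_eq0; apply/eqP.
transitivity ((a ^+ 2 + r o ^+ 2 - r u ^+ 2 - 2 * a * w1) +
  (2 * (dot / a * w1 + z / a * w2) - (b ^+ 2 + r o ^+ 2 - r v ^+ 2)) +
  (b ^+ 2 - ((dot / a) ^+ 2 + (z / a) ^+ 2))); first by ring.
by rewrite e1 e2 e3 !subrr !addr0.
Qed.

Lemma face_theta : 0 < gram p q s x y -> 0 < x + p ->
  theta I r o u v =
  atan (height p q s x y / ((x + p) * Num.sqrt (gram p q s x y))).
Proof.
move=> Q0 xp0.
have := face_gram_eq0; rewrite (gt_eqF Q0) => /esym/negbT.
rewrite !negb_or => /and3P[/negbTE f1 /negbTE f2 /negbTE f3].
rewrite /theta f1 f2 f3 /= face_edge_h//.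
have dE : edge_d I r o u = r o * r u * (x + p) / a.
  by rewrite /edge_d -/a -/p /x; field; rewrite ru0 lt0r_neq0.
have d0 : 0 < edge_d I r o u by rewrite dE divr_gt0// !mulr_gt0.
rewrite ltNge (ltW d0)/= (gt_eqF d0) dE; congr atan.
have g0 : Num.sqrt (gram p q s x y) != 0 by rewrite lt0r_neq0// sqrtr_gt0.
have xp_neq0 := lt0r_neq0 xp0; have a_neq0 := lt0r_neq0 a0.
have ro0 := lt0r_neq0 (r0 o).
by field; do ?[apply/andP; split].
Qed.

(** In a degenerate face [dot] is ab or -ab. The sign of [height] then follows because nonnegative
    weights make each squared length at least the sum of the squared radii. *)
Lemma face_theta_flat : 0 <= p -> 0 <= q -> 0 <= s -> gram p q s x y = 0 ->
  theta I r o u v = pi / 2 /\ 0 < height p q s x y \/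
  theta I r o u v = - (pi / 2) /\ height p q s x y < 0.
Proof.
move=> p0 q0 s0 /eqP; rewrite face_gram_eq0.
have k0 : 0 < r o * r u ^+ 2 * r v by rewrite !mulr_gt0 ?exprn_gt0.
have A2 : r o ^+ 2 + r u ^+ 2 <= a ^+ 2.
  by rewrite a_sqr lerDl !mulr_ge0// ltW.
have B2 : r o ^+ 2 + r v ^+ 2 <= b ^+ 2.
  by rewrite b_sqr lerDl !mulr_ge0// ltW.
have C2 : r u ^+ 2 + r v ^+ 2 <= c ^+ 2.
  by rewrite c_sqr lerDl !mulr_ge0// ltW.
have ro2 : 0 < r o ^+ 2 by rewrite exprn_gt0.
have ru2 : 0 < r u ^+ 2 by rewrite exprn_gt0.
have rv2 : 0 < r v ^+ 2 by rewrite exprn_gt0.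
rewrite /theta; case: ifPn => [f _|nf].
  left; split=> //; rewrite -(pmulr_rgt0 _ k0) heightE divr_gt0//.
  case/orP: f; rewrite /flat ?len_uo ?len_vo ?len_vu -/a -/b -/c => /eqP e.
    have -> : dot = - (a * b) by rewrite /dot e; field.
    have -> : a ^+ 2 * (b ^+ 2 + r o ^+ 2 - r v ^+ 2) -
       - (a * b) * (a ^+ 2 + r o ^+ 2 - r u ^+ 2) =
       a * (a * (b ^+ 2 + r o ^+ 2 - r v ^+ 2) +
            b * (a ^+ 2 + r o ^+ 2 - r u ^+ 2)) by ring.
    by rewrite mulr_gt0// addr_gt0// mulr_gt0//; lra.
  have -> : dot = a * b by rewrite /dot e; field.
  have -> : a ^+ 2 * (b ^+ 2 + r o ^+ 2 - r v ^+ 2) -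
       a * b * (a ^+ 2 + r o ^+ 2 - r u ^+ 2) =
       a * (c * (a ^+ 2 - r u ^+ 2 - r o ^+ 2) +
            a * (c ^+ 2 - r u ^+ 2 - r v ^+ 2) + (a + b + c) * r u ^+ 2).
    by rewrite e; ring.
  rewrite mulr_gt0// ltr_wpDl ?mulr_gt0 ?addr_gt0//.
  by rewrite addr_ge0// mulr_ge0 ?(ltW a0) ?(ltW c0)//; lra.
move: nf; rewrite negb_or => /andP[/negbTE -> /negbTE ->] /= f; rewrite f.
right; split=> //; rewrite -(pmulr_rlt0 _ k0) heightE.
move: f; rewrite /flat -/a -/b -/c => /eqP e.
have -> : dot = a * b by rewrite /dot e; field.
have -> : (a ^+ 2 * (b ^+ 2 + r o ^+ 2 - r v ^+ 2) -
       a * b * (a ^+ 2 + r o ^+ 2 - r u ^+ 2)) / 2 =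
       - (a * (c * (b ^+ 2 - r v ^+ 2 - r o ^+ 2) +
            b * (c ^+ 2 - r u ^+ 2 - r v ^+ 2) + 2 * a * r v ^+ 2) / 2).
  by rewrite e; field.
rewrite oppr_lt0 divr_gt0// mulr_gt0// ltr_wpDl ?mulr_gt0//.
by rewrite addr_ge0// mulr_ge0 ?(ltW b0) ?(ltW c0)//; lra.
Qed.

Lemma face_theta_spec : 1 < p ->
  theta_spec (x + p) (height p q s x y) (gram p q s x y) (theta I r o u v).
Proof.
move=> p_gt1; have xp0 : 0 < x + p by rewrite addr_gt0 ?divr_gt0//; lra.
have := face_gram_ge0; rewrite le_eqVlt => /orP[/eqP/esym Q0|Q0]; last first.
  by left; split=> //; exact: face_theta.
have [_ [_ [[p_le1 _ _]|[p0 q0 s0]]]] := fw.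
  by move: p_le1; rewrite -/p leNgt p_gt1.
by right; split=> //; exact: face_theta_flat.
Qed.

End FaceGeometry.

(** * From packings to the hypotheses of the rigidity statement *)

Section StarPacking.
Variables (R : realType) (n : nat) (I : vertex n -> vertex n -> R).
Hypothesis I_weight : edge_weight I.
Hypothesis I_range : (forall x y, edge x y -> -1 < I x y <= 1) \/
  (forall x y, edge x y -> 0 <= I x y).
Hypothesis I_structure : structure_condition I.

Let p i := I None (Some i).
Let s i := I (Some i) (Some (ordS i)).

Let edge_next i : edge (Some i : vertex n) (Some (ordS i)).
Proof. by rewrite /= eqxx. Qed.

Let edge_prev i : edge (Some (ordS i) : vertex n) (Some i).
Proof. by rewrite /= eqxx orbT. Qed.

Lemma structure_face_weights i : face_weights (p i) (p (ordS i)) (s i).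
Proof.
have [g1 g2 g3] := I_structure i.
have e := edge_next i.
case: I_range => h; split.
- by split; [have /andP[] := h None (Some i) isT
            |have /andP[] := h None (Some (ordS i)) isT
            |have /andP[] := h _ _ e].
- split=> //; left.
  by split; [have /andP[] := h None (Some i) isT
            |have /andP[] := h None (Some (ordS i)) isT
            |have /andP[] := h _ _ e].
- by split; apply: (@lt_le_trans _ _ 0); rewrite ?ltrN10// h.
- by split=> //; right; split; rewrite h.
Qed.

Lemma opposite_weight_pred i : I (Some i) (Some (ord_pred i)) = s (ord_pred i).
Proof.
rewrite /s ord_predK; apply: I_weight.
by have := edge_prev (ord_pred i); rewrite ord_predK.
Qed.

Variable r : vertex n -> R.
Hypothesis r_packing : generalized_packing I r.

Definition inv_ratio i : R := r None / r (Some i).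

Let x := inv_ratio.
Let r_gt0 v : 0 < r v. Proof. by case: r_packing. Qed.
Let Iv0 i : I (Some i) None = I None (Some i). Proof. exact: I_weight. Qed.
Let Ivv i : I (Some (ordS i)) (Some i) = I (Some i) (Some (ordS i)).
Proof. exact: I_weight (edge_prev i). Qed.

Lemma packing_gram_ge0 i :
  0 <= gram (p i) (p (ordS i)) (s i) (x i) (x (ordS i)).
Proof.
have [_ /(_ i)[t1 t2 t3]] := r_packing.
exact: (face_gram_ge0 r_gt0 (structure_face_weights i)).
Qed.

Lemma packing_K0 : K0 I r = 2 * pi - total_angle p s x.
Proof.
congr (_ - _); apply: eq_bigr => i _.
have [_ /(_ i)[t1 t2 t3]] := r_packing.
exact: (face_angle r_gt0 (Iv0 _) (Iv0 _) (Ivv _) (structure_face_weights i)).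
Qed.

Lemma packing_slope_ge0 i : weighted_delaunay I r -> 1 < p i ->
  0 <= slope p s x i.
Proof.
move=> /(_ i) del p_gt1.
have fw := structure_face_weights i.
have fw' : face_weights (p i) (p (ord_pred i)) (I (Some i) (Some (ord_pred i))).
  rewrite opposite_weight_pred; apply: face_weightsC.
  by have := structure_face_weights (ord_pred i); rewrite ord_predK.
have Ivv' : I (Some (ord_pred i)) (Some i) = I (Some i) (Some (ord_pred i)).
  by have := Ivv (ord_pred i); rewrite ord_predK.
have [_ tri] := r_packing.
have [t1 t2 t3] := tri i.
have := tri (ord_pred i); rewrite ord_predK /= (lenC _ Ivv') => -[u1 u2 u3].
rewrite [leRHS]addrC in u3.
have th := face_theta_spec r_gt0 (Iv0 _) (Iv0 _) (Ivv _) fw t1 t2 t3 p_gt1.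
(* The preceding face is read as v_0, v_i, v_(i-1), so its first two triangle inequalities change
   places. *)
have th' := face_theta_spec r_gt0 (Iv0 _) (Iv0 _) Ivv' fw' u2 u1 u3 p_gt1.
rewrite opposite_weight_pred in fw' th'.
have x0 : 0 < x i by rewrite divr_gt0.
have p_gtN1 : -1 < p i by lra.
rewrite addrC in del.
have gramE q1 q2 z y : (q1 ^+ 2 - 1) * gram q1 q2 z (x i) y =
    edge_form q1 (x i) * discr q1 q2 z - height q1 q2 z (x i) y ^+ 2.
  by rewrite height_sqr; ring.
apply: (slope_of_theta _ (edge_form_gt0 p_gtN1 x0) _ (discr_gt0 fw p_gt1)
  (discr_gt0 fw' p_gt1) (gramE _ _ _ _) (gramE _ _ _ _) th th' del).
- exact: addr_gt0 x0 (lt_trans ltr01 p_gt1).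
- by rewrite subr_gt0 expr_gt1// (ltW (lt_trans ltr01 p_gt1)).
Qed.

End StarPacking.

Theorem theorem3p1 (R : realType) (n : nat) (n_ge3 : (3 <= n)%N)
    (I : vertex n -> vertex n -> R) (rbar r : vertex n -> R)
    (I_weight : edge_weight I)
    (I_regular : regular_weight I)
    (I_range : (forall x y, edge x y -> -1 < I x y <= 1) \/
               (forall x y, edge x y -> 0 <= I x y))
    (I_structure : structure_condition I)
    (rbar_packing : generalized_packing I rbar)
    (r_packing : generalized_packing I r)
    (rbar_delaunay : weighted_delaunay I rbar)
    (r_delaunay : weighted_delaunay I r)
    (K0_le : K0 I r <= K0 I rbar)
    (ratio_max : forall i : 'I_n,
       r (Some i) / rbar (Some i) <= r None / rbar None) :
  exists c : R, forall x : vertex n, r x / rbar x = c.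

Proof.
have x_gt0 (rho : vertex n -> R) : generalized_packing I rho ->
    forall i, 0 < inv_ratio rho i.
  by move=> [rho0 _] i; rewrite divr_gt0.
have [r_gt0 _] := r_packing; have [rb_gt0 _] := rbar_packing.
(* Condition (c) after cross-multiplication. *)
have le i : inv_ratio rbar i <= inv_ratio r i.
  rewrite /inv_ratio ler_pdivrMr// mulrAC ler_pdivlMr//.
  have := ratio_max i; rewrite ler_pdivrMr// mulrAC ler_pdivlMr//.
  by rewrite mulrC [X in _ <= X]mulrC.
have eq_ratio := star_rigidity (structure_face_weights I_range I_structure)
  (x_gt0 _ r_packing) (x_gt0 _ rbar_packing) le
  (packing_gram_ge0 I_range I_structure r_packing)
  (packing_gram_ge0 I_range I_structure rbar_packing)
  (fun i => packing_slope_ge0 I_weight I_range I_structure r_packing r_delaunay)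
  (fun i => packing_slope_ge0 I_weight I_range I_structure rbar_packing
    rbar_delaunay).
exists (r None / rbar None) => -[i|//].
have /eqP : inv_ratio r i = inv_ratio rbar i.
  apply: eq_ratio => [j [e1 e2 e3]|].
    by apply: (I_regular j); rewrite opposite_weight_pred.
  (* The smaller curvature K_0(r) means the larger total angle. *)
  move: K0_le; rewrite !packing_K0//; lra.
rewrite /inv_ratio eqr_div ?lt0r_neq0// => /eqP e.
apply/eqP; rewrite eqr_div ?lt0r_neq0//; apply/eqP.
by move: e; rewrite mulrC => ->; rewrite mulrC.
Qed.
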